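(* Let $n,r\ge1$ be integers. The $\mathbb{Z}$-linear map $\omega_0:M(n,r)\to M(D(n,r))$ with $\omega_0(o_{\underline d,\underline e})=E_{\underline d,\underline e}$ for all $\underline d,\underline e\in D(n,r)$ is an isomorphism of $\mathbb{Z}$-algebras.
   Context: Generic algebra $G(n,r)$. Let $k$ be an algebraically closed field, $V$ an $r$-dimensional $k$-space, $\mathcal{F}$ the variety of $n$-step flags $f:\{0\}=V_0\subseteq\cdots\subseteq V_n=V$. $\mathrm{GL}(V)$-orbits in $\mathcal{F}\times\mathcal{F}$ (diagonal action) are in bijection with $n\times n$ matrices of non-negative integers with entries summing to $r$ via $A(f,f')_{ij}=\dim(V_{i-1}+V_i\cap V'_j)-\dim(V_{i-1}+V_i\cap V'_{j-1})$; $e_A$ is the orbit with matrix $A$. Let $S(A,A')=\{(f_1,f_2): \exists f\in\mathcal{F},\ (f_1,f)\in e_A,\ (f,f_2)\in e_{A'}\}$; if non-empty it contains a unique $\mathrm{GL}(V)$-orbit open in it (Zariski topology). $G(n,r)$ is the free $\mathbb{Z}$-module with basis the orbits $e_A$ and bilinear associative product $e_A\star e_{A'}$ equal to the open orbit in $S(A,A')$ if $S(A,A')\ne\emptyset$, and $0$ otherwise. $D(n,r)$ is the set of $n$-tuples $\underline d$ of non-negative integers with sum $r$, and $\mathcal{F}_{\underline d}$ is the set of flags with $\dim V_i-\dim V_{i-1}=d_i$ for all $i$. For $\underline d,\underline e\in D(n,r)$, $o_{\underline d,\underline e}$ is the unique open $\mathrm{GL}(V)$-orbit in $\mathcal{F}_{\underline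 d}\times\mathcal{F}_{\underline e}$. $M(n,r)\subseteq G(n,r)$ is the $\mathbb{Z}$-submodule with basis all $o_{\underline d,\underline e}$, with the product $\star$ (it is closed under $\star$). $M(D(n,r))$ is the algebra of $|D(n,r)|\times|D(n,r)|$ matrices over $\mathbb{Z}$, rows and columns indexed by $D(n,r)$, and $E_{\underline d,\underline e}$ is the $(\underline d,\underline e)$ elementary matrix. *)

(* Defs.v *)
From HB Require Import structures.
From mathcomp Require Import all_boot all_order all_algebra.
From mathcomp Require Import boolp classical_sets.
From mathcomp Require Import mpoly.

Set Implicit Arguments.
Unset Strict Implicit.
Unset Printing Implicit Defensive.

Import GRing.Theory.
Local Open Scope classical_set_scope.
Local Open Scope ring_scope.

(** * Flags and the diagonal action of GL(V) *)

Section Flags.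
Variables (k : closedFieldType) (V : vectType k) (n : nat).

Definition is_flag (s : n.+1.-tuple {vspace V}) : bool :=
  [&& head 0%VS s == 0%VS, last 0%VS s == fullv & sorted (@subsetv k V) s].

Definition flag := {s : n.+1.-tuple {vspace V} | is_flag s}.

(* V_i, meaningful for 0 <= i <= n. *)
Definition step (f : flag) (i : nat) : {vspace V} := nth 0%VS (val f) i.

Definition gl_orbit (p : flag * flag) : set (flag * flag) :=
  [set q | exists2 g : 'End(V), lker g == 0%VS &
     forall i, (i <= n)%N -> step q.1 i = (g @: step p.1 i)%VS /\
                             step q.2 i = (g @: step p.2 i)%VS].

Definition is_orbit (O : set (flag * flag)) : Prop := exists p, O = gl_orbit p.

(* The (i+1, j+1) entry of A(f, f'), the indices in 'I_n being 0-based.  The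
   natural number subtraction is exact, because the second space is contained
   in the first. *)
Definition rel_entry (p : flag * flag) (i j : nat) : nat :=
  (\dim (step p.1 i + (step p.1 i.+1 :&: step p.2 j.+1))%VS
   - \dim (step p.1 i + (step p.1 i.+1 :&: step p.2 j))%VS)%N.

(** * The Zariski topology on pairs of flags *)

(* A pair of flags is a point of a product of projective spaces P(\Lambda V),
   one factor for each of the 2(n+1) subspaces: a subspace U of dimension d is
   sent to the line \Lambda^d U of \Lambda V.  In the fixed basis
   [vbasis {:V}], the homogeneous coordinates on P(\Lambda V) are indexed by
   the sets I of basis indices; those with #|I| = d restrict to the Plücker
   coordinates of Gr(d, V), and the others vanish on it.  The disjoint union of
   the Gr(d, V) is thus embedded as a closed subset. *)
Definition plucker (U : {vspace V}) (I : {set 'I_(\dim {:V})}) : k :=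
  if #|I| == \dim U then
    \det (\matrix_(a < #|I|, b < #|I|)
            coord (vbasis {:V}) (enum_val b) (vbasis U)`_a)
  else 0.

(* The factors: (false, i) stands for V_i and (true, i) for V'_i. *)
Definition factor := (bool * 'I_n.+1)%type.

Definition pvar := (factor * {set 'I_(\dim {:V})})%type.

Definition plucker_pair (p : flag * flag) (x : pvar) : k :=
  plucker (step (if x.1.1 then p.2 else p.1) x.1.2) x.2.

Definition multihomogeneous (P : {mpoly k[#|{: pvar}|]}) : Prop :=
  forall c : factor, exists D : nat, forall m, m \in msupp P ->
    (\sum_(I : {set 'I_(\dim {:V})}) m (enum_rank ((c, I) : pvar)))%N = D.

(* Whether a multihomogeneous polynomial vanishes does not depend on the
   homogeneous coordinates that [plucker] chooses. *)
Definition zariski_closed (Z : set (flag * flag)) : Prop :=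
  exists2 E : set {mpoly k[#|{: pvar}|]},
    (forall P, E P -> multihomogeneous P) &
    Z = [set p | forall P, E P ->
                   P.@[fun x => plucker_pair p (enum_val x)] = 0].

(* U is a subset of S that is open for the topology induced on S. *)
Definition open_in (S U : set (flag * flag)) : Prop :=
  exists2 Z, zariski_closed Z & U = S `\` Z.

End Flags.

(** * The index sets *)

(* Non-negative integers with sum r are at most r, whence the type 'I_r.+1. *)
Definition Theta (n r : nat) :=
  {A : 'M['I_r.+1]_n | (\sum_i \sum_j (A i j : nat) == r)%N}.

Definition D (n r : nat) :=
  {d : {ffun 'I_n -> 'I_r.+1} | (\sum_i (d i : nat) == r)%N}.

Definition matD (n r : nat) := 'M[int]_#|{: D n r}|.

(** * The generic algebra *)

Definition G (n r : nat) : zmodType := {ffun Theta n r -> int}.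

Definition basisG (n r : nat) (A : Theta n r) : G n r :=
  [ffun B => (B == A)%:R].

Section Generic.
Variables (k : closedFieldType) (V : vectType k) (n r : nat).

Definition orbit_of (A : Theta n r) : set (flag V n * flag V n) :=
  [set p | forall i j : 'I_n, rel_entry p i j = val A i j].

(* The basis element of G(n, r) given by the GL(V)-orbit that is open in S,
   and 0 if S has no open orbit. *)
Definition open_orbit (S : set (flag V n * flag V n)) : G n r :=
  if [pick A : Theta n r | `[< is_orbit (orbit_of A) /\
                               open_in S (orbit_of A) >]] is Some A
  then basisG A else 0.

Definition composable (A A' : Theta n r) : set (flag V n * flag V n) :=
  [set p | exists f, orbit_of A (p.1, f) /\ orbit_of A' (f, p.2)].

Definition star_basis (A A' : Theta n r) : G n r :=
  if `[< composable A A' !=set0 >] then open_orbit (composable A A') else 0.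

Definition star (x y : G n r) : G n r :=
  \sum_A \sum_A' star_basis A A' *~ (x A * y A').

Definition flags_of_type (d : D n r) : set (flag V n) :=
  [set f | forall i : 'I_n,
     (\dim (step f i.+1) - \dim (step f i))%N = val d i].

Definition o (d e : D n r) : G n r :=
  open_orbit (flags_of_type d `*` flags_of_type e).

(** * The submodule spanned by the open orbits *)

Definition in_M : {pred G n r} := fun x =>
  `[< exists c : D n r -> D n r -> int, x = \sum_d \sum_e o d e *~ c d e >].

Lemma in_M_zmod_closed : zmod_closed in_M.
Proof.
split.
  apply/asboolP; exists (fun _ _ => 0).
  by rewrite big1 // => d _; rewrite big1 // => e _; rewrite mulr0z.
move=> x y /asboolP[c ->] /asboolP[c' ->].
apply/asboolP; exists (fun d e => c d e - c' d e).
rewrite -sumrB; apply: eq_bigr => d _; rewrite -sumrB.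
by apply: eq_bigr => e _; rewrite mulrzBr.
Qed.

HB.instance Definition _ :=
  GRing.isZmodClosed.Build (G n r) in_M in_M_zmod_closed.

Record M := MkM { M_val : G n r; M_valP : M_val \in in_M }.

HB.instance Definition _ := [isSub for M_val].
HB.instance Definition _ := [Choice of M by <:].
HB.instance Definition _ := [SubChoice_isSubZmodule of M by <:].

Lemma o_in_M (d e : D n r) : o d e \in in_M.
Proof.
apply/asboolP; exists (fun d' e' => ((d' == d) && (e' == e))%:R).
rewrite (bigD1 d) //= (bigD1 e) //= !eqxx mulr1z !big1 ?addr0 //.
  by move=> d' /negbTE nd; rewrite big1 // => e' _; rewrite nd mulr0z.
by move=> e' /negbTE ne; rewrite ne mulr0z.
Qed.

Definition oM (d e : D n r) : M := Sub (o d e) (o_in_M d e).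

Definition is_omega0 (w : {additive M -> matD n r}) : Prop :=
  forall d e, w (oM d e) = delta_mx (enum_rank d) (enum_rank e).

(* The first two clauses include the facts that M is closed under the product
   and that it has a unit. *)
Definition is_Zalgebra_iso (w : {additive M -> matD n r}) : Prop :=
  [/\ bijective w,
      forall x y : M, exists2 z : M,
        val z = star (val x) (val y) & w z = w x *m w y
    & exists2 u : M,
        forall x : M, star (val u) (val x) = val x /\
                      star (val x) (val u) = val x
      & w u = 1%:M].

End Generic.

(* Main.v *)
Require Import Defs.
From HB Require Import structures.
From mathcomp Require Import mpoly boolp classical_sets.
From mathcomp Require Import all_boot all_order all_fingroup all_algebra.
From mathcomp Require Import zify.
Set Implicit Arguments.
Unset Strict Implicit.
Unset Printing Implicit Defensive.
Import GRing.Theory passmx.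
Local Open Scope ring_scope.

(** Write F_d for the flags of type d.  Two flags are in general position when
    dim (V_i + V'_j) = min (r, dim V_i + dim V'_j) for all i and j, and
    [generic_pairs d e] is the set of such pairs in F_d x F_e.  Everything
    follows from four properties of this set.

    - It is one GL(V)-orbit, and it is the set e_A of some matrix A
      ([generic_pairs_orbit], [orbit_of_generic_pairs]).  A pair in general
      position has a common basis x_1, ..., x_r for which V_i is spanned by the
      first dim V_i vectors and V'_j by the last dim V'_j ([adapted_basis]);
      a linear automorphism moves any such basis to any other.

    - It is open in F_d x F_e ([generic_pairs_open_in]).  For two subspaces of
      given dimensions, general position is witnessed by a determinant whose
      rows depend linearly on bases of the two subspaces
      ([general_position_detector]), and by a Cauchy-Binet expansion such a
      determinant is bilinear in the two families of Plücker coordinates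
      ([det_col_mx_colminor]).

    - It is dense in F_d x F_e ([generic_pairs_dense]).  Given any pair, some
      automorphism g makes it generic; along the segment (1 - t) + t g the
      Plücker coordinates are polynomials in t, up to scalars that a
      multihomogeneous polynomial does not see ([horner_segment_eval]).  Hence a
      closed condition that holds on generic pairs holds for all but finitely
      many t, thus also at t = 0.  Density makes the open orbit unique, so that
      [o d e] is the basis element of [generic_pairs d e] ([open_orbit_thetaD]).

    - Any f in F_d and h in F_d' have a common opposite flag in every F_e
      ([common_opposite_flag]): a flag opposite to f and one opposite to h are
      joined by a segment, and each condition fails for finitely many t only.

    By the last property the set of composable pairs for o_(d,e) and o_(e,d')
    contains [generic_pairs d d'], so the product is o_(d,d'); when the middle
    types differ no pair is composable ([star_o]).  Thus the o_(d,e), which are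
    distinct basis elements, multiply as matrix units. *)

(** * Bases adapted to two chains in general position *)

Section AdaptedBases.
Variables (k : fieldType) (V : vectType k).
Local Notation r := (\dim {:V}).

(** A flag of subspaces without reference to a tuple, so that short auxiliary
    chains can be used beside the steps of a flag. *)
Record chain (n : nat) (P : nat -> {vspace V}) : Prop := Chain {
  chain0 : P 0%N = 0%VS;
  chainT : P n = fullv;
  chain_le : forall i j, (i <= j <= n)%N -> (P i <= P j)%VS }.

Definition in_general_position (n1 n2 : nat) (P Q : nat -> {vspace V}) :=
  forall i j, (i <= n1)%N -> (j <= n2)%N ->
    \dim (P i + Q j)%VS = minn r (\dim (P i) + \dim (Q j)).

Lemma dim_le_full (U : {vspace V}) : (\dim U <= r)%N.
Proof. exact: dimvS (subvf U). Qed.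

Lemma basis_of_full_size (X : seq V) : basis_of fullv X -> size X = r.
Proof. by move=> bX; rewrite (@size_basis _ _ _ _ (in_tuple X) bX). Qed.

Lemma basis_of_full_free (X : seq V) : free X -> size X = r -> basis_of fullv X.
Proof.
by move=> fX sX; rewrite basisEfree fX /= sX leqnn andbT; apply/subvP => v _; apply: memvf.
Qed.

Lemma span_free_eq (X : seq V) (U : {vspace V}) :
  free X -> {subset X <= U} -> size X = \dim U -> <<X>>%VS = U.
Proof.
move=> fX XU sX; apply/eqP; rewrite eqEdim (introT span_subvP XU) /=.
by rewrite (eqP fX) sX.
Qed.

Lemma dim_span_rcons (X : seq V) v (U : {vspace V}) :
  v \notin (<<X>> + U)%VS ->
  \dim (<<rcons X v>> + U)%VS = (\dim (<<X>> + U)%VS).+1.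
Proof.
move=> vXU; rewrite -cats1 span_cat span_seq1 -addvA [(<[v]> + U)%VS]addvC addvA.
have := dimv_sum_cap (<<X>> + U)%VS <[v]>%VS.
have -> : ((<<X>> + U) :&: <[v]> = 0)%VS.
  apply/eqP; rewrite -subv0; apply/subvP => w; rewrite memv_cap => /andP[wXU].
  case/vlineP => c Ec; move: wXU; rewrite Ec memv0.
  have [->|c0] := eqVneq c 0; first by rewrite scale0r.
  by move=> /(memvZ c^-1); rewrite scalerA mulVf // scale1r => /(negP vXU).
rewrite dimv0 addn0 => ->; rewrite dim_vline.
by case: eqVneq vXU => [->|_] /=; rewrite ?mem0v ?addn1.
Qed.

(** The vector that prolongs an adapted family s of m vectors.  With i and j the
    least indices such that dim P_i > m and dim Q_j >= r - m, it has to be in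
    the intersection of P_i and Q_j but outside <s> + Q_(j-1).  If there were no
    such vector, the modular law would give P_i <= <s> + (P_i :&: Q_(j-1)),
    which general position excludes by counting dimensions. *)
Lemma adapted_step n1 n2 P Q m (s : seq V) :
  chain n1 P -> chain n2 Q -> in_general_position n1 n2 P Q ->
  size s = m -> (m < r)%N ->
  (forall l i, (l < m)%N -> (i <= n1)%N -> (l < \dim (P i))%N -> s`_l \in P i) ->
  (forall j, (j <= n2)%N -> \dim (<<s>> + Q j) = minn r (m + \dim (Q j))) ->
  exists v : V,
  [/\ forall i, (i <= n1)%N -> (m < \dim (P i))%N -> v \in P i,
      forall j, (j <= n2)%N -> (r - \dim (Q j) <= m)%N -> v \in Q j
    & forall j, (j <= n2)%N -> (m + \dim (Q j) < r)%N -> v \notin (<<s>> + Q j)%VS].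
Proof.
move=> cP cQ gen sm mr sP sQ.
have exi : exists i, (i <= n1)%N && (m < \dim (P i))%N.
  by exists n1; rewrite leqnn (chainT cP).
have exj : exists j, (j <= n2)%N && (r - \dim (Q j) <= m)%N.
  by exists n2; rewrite leqnn (chainT cQ) subnn.
case: (ex_minnP exi) => i /andP[in1 mi] mini.
case: (ex_minnP exj) => j /andP[jn2 mj] minj.
have j0 : (0 < j)%N by case: j jn2 mj {minj} => //; rewrite (chain0 cQ) dimv0; lia.
have jp2 : (j.-1 <= n2)%N by lia.
have mjp : (m < r - \dim (Q j.-1))%N.
  by rewrite ltnNge; apply/negP => H; have := minj j.-1; rewrite jp2 H => /(_ isT); lia.
have sPi : (<<s>> <= P i)%VS.
  apply/span_subvP => _ /(nthP 0)[l ls <-]; apply: sP => //; first by rewrite -sm.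
  by apply: leq_trans mi; rewrite -sm ltnW.
have dims : \dim <<s>> = m.
  by have := sQ 0%N isT; rewrite (chain0 cQ) addv0 dimv0 addn0; lia.
have sQj : (<<s>> + Q j)%VS = fullv.
  by apply/eqP; rewrite eqEdim subvf sQ //; lia.
(* P i = <<s>> + (P i :&: Q j), so this inclusion would put P i in <<s>> + Q j.-1. *)
have /subvPn[v] : ~~ (P i :&: Q j <= <<s>> + Q j.-1)%VS.
  apply/negP => H.
  have H2 : (P i <= <<s>> + (Q j.-1 :&: P i))%VS.
    rewrite (vspace_modl _ sPi) subv_cap subvv andbT.
    apply: (@subv_trans _ _ (<<s>> + (Q j :&: P i))%VS).
      by rewrite (vspace_modl _ sPi) sQj capfv.
    by rewrite subv_add addvSl capvC.
  have := dimvS H2; have := (dimv_add_leqif <<s>> (Q j.-1 :&: P i)).1.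
  have := dimv_sum_cap (P i) (Q j.-1); rewrite gen // [(Q _ :&: _)%VS]capvC dims.
  move: mi mjp; move: (\dim (P i :&: _)) (\dim (P i)) (\dim (Q _)) => a b c.
  move: (\dim (<<s>> + _)); lia.
rewrite memv_cap => /andP[vP vQ] vn; exists v; split.
- move=> i' i'n mi'; apply: (subvP _ _ vP); apply: (chain_le cP).
  by rewrite mini //= i'n.
- move=> j' j'n mj'; apply: (subvP _ _ vQ); apply: (chain_le cQ).
  by rewrite minj //= j'n.
- move=> j' j'n mj'; apply: contra vn; apply: subvP; apply: addvS => //.
  apply: (chain_le cQ); rewrite jp2 andbT -ltnS prednK //.
  rewrite ltnNge; apply/negP => jj'.
  by have := dimvS (chain_le cQ (i:=j) (j:=j') _); rewrite jj' j'n => /(_ isT); lia.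
Qed.

(** The basis is built greedily from left to right, keeping the span of the
    vectors chosen so far in general position with every Q_j. *)
Lemma adapted_basis n1 n2 P Q :
  chain n1 P -> chain n2 Q -> in_general_position n1 n2 P Q ->
  exists X : seq V, [/\ basis_of fullv X,
    forall i, (i <= n1)%N -> P i = <<take (\dim (P i)) X>>%VS &
    forall j, (j <= n2)%N -> Q j = <<drop (r - \dim (Q j)) X>>%VS].
Proof.
move=> cP cQ gen.
have greedy m : (m <= r)%N -> exists s : seq V, [/\ size s = m,
    forall l i, (l < m)%N -> (i <= n1)%N -> (l < \dim (P i))%N -> s`_l \in P i,
    forall l j, (l < m)%N -> (j <= n2)%N -> (r - \dim (Q j) <= l)%N -> s`_l \in Q j
    & forall j, (j <= n2)%N -> \dim (<<s>> + Q j) = minn r (m + \dim (Q j))].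
  elim: m => [|m IHm] mr.
    exists [::]; split=> // j jn; rewrite span_nil add0v add0n.
    by rewrite (minn_idPr (dim_le_full _)).
  have [s [sm sP sQ sD]] := IHm (ltnW mr).
  have [v [vP vQ vD]] := adapted_step cP cQ gen sm mr sP sD.
  exists (rcons s v); split; first by rewrite size_rcons sm.
  - move=> l i; rewrite ltnS leq_eqVlt nth_rcons sm => /orP[/eqP->|lm].
      by rewrite ltnn eqxx; exact: vP.
    by rewrite lm; exact: sP.
  - move=> l i; rewrite ltnS leq_eqVlt nth_rcons sm => /orP[/eqP->|lm].
      by rewrite ltnn eqxx; exact: vQ.
    by rewrite lm; exact: sQ.
  - move=> j jn; have [mj|mj] := ltnP (m + \dim (Q j)) r.
      by rewrite dim_span_rcons ?vD // sD //; lia.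
    have -> : (<<rcons s v>> + Q j = fullv)%VS.
      apply/eqP; rewrite eqEsubv subvf /=.
      have -> : (fullv = <<s>> + Q j)%VS.
        by apply/eqP; rewrite eq_sym eqEdim subvf sD //; lia.
      apply: addvS => //; apply: sub_span => x xs.
      by rewrite mem_rcons inE xs orbT.
    lia.
have [X [sX XP XQ XD]] := greedy r (leqnn r).
have fX : free X.
  rewrite /free sX; have := XD 0%N isT.
  by rewrite (chain0 cQ) addv0 dimv0 addn0 minnn => ->.
exists X; split.
- exact: basis_of_full_free.
- move=> i iN; apply/esym/span_free_eq.
  + by move: fX; rewrite -{1}(cat_take_drop (\dim (P i)) X); exact: catl_free.
  + move=> _ /(nthP 0)[l ll <-]; move: ll; rewrite size_take_min sX => ll.
    by rewrite nth_take; [apply: XP|] => //; lia.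
  + by rewrite size_take_min sX; apply/minn_idPl/dim_le_full.
- move=> j jN; apply/esym/span_free_eq.
  + by move: fX; rewrite -{1}(cat_take_drop (r - \dim (Q j)) X); exact: catr_free.
  + move=> _ /(nthP 0)[l ll <-]; move: ll; rewrite size_drop sX => ll.
    by rewrite nth_drop; apply: XQ => //; lia.
  + by rewrite size_drop sX subKn // dim_le_full.
Qed.

Lemma dim_take_drop (X : seq V) a c : basis_of fullv X ->
  (a <= r)%N -> (c <= r)%N ->
  \dim (<<take a X>> + <<drop (r - c) X>>)%VS = minn r (a + c).
Proof.
move=> bX ar cr; have sX := basis_of_full_size bX; have fX := basis_free bX.
have [h|h] := leqP (r - c) a.
  have -> : (<<take a X>> + <<drop (r - c) X>>)%VS = fullv.
    apply/eqP; rewrite eqEsubv subvf /= -(span_basis bX) -span_cat.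
    apply: sub_span => x; rewrite -{1}(cat_take_drop a X) !mem_cat => /orP[->//|xd].
    apply/orP; right; move: xd.
    have -> : drop a X = drop (a - (r - c)) (drop (r - c) X) by rewrite drop_drop subnK.
    by move=> /mem_drop; rewrite (span_basis bX).
  lia.
have : subseq (take a X ++ drop (r - c) X) X.
  rewrite -{3}(cat_take_drop a X); apply: cat_subseq => //.
  have -> : drop (r - c) X = drop (r - c - a) (drop a X).
    by rewrite drop_drop subnK // ltnW.
  exact: drop_subseq.
move=> sub; rewrite -span_cat.
have -> : \dim <<take a X ++ drop (r - c) X>> = size (take a X ++ drop (r - c) X).
  case: (perm_to_subseq sub) => Y /perm_free; rewrite fX => /esym/catl_free.
  by move/eqP.
by rewrite size_cat size_drop size_take_min sX; lia.
Qed.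

Lemma lker0_move_basis (X Y : seq V) : basis_of fullv X -> basis_of fullv Y ->
  exists2 g : 'End(V), lker g == 0%VS & map g X = Y.
Proof.
move=> bX bY; have [f fE] := linear_of_free X Y.
have gE : map (linfun f) X = Y.
  have := fE (basis_free bX); rewrite (basis_of_full_size bX) (basis_of_full_size bY).
  by move=> /(_ erefl) <-; apply: eq_map => v; rewrite lfunE.
exists (linfun f) => //.
have imf : limg (linfun f) = fullv by rewrite -{1}(span_basis bX) limg_span gE (span_basis bY).
have := limg_ker_dim (linfun f) fullv; rewrite capfv imf => /eqP.
by rewrite -{2}[r]add0n eqn_add2r dimv_eq0.
Qed.
End AdaptedBases.

(** * Minors of a product of block rows *)

Section Minors.
Variable R : comNzRingType.
Implicit Types m n : nat.

(** The minor of the columns in I, in increasing order; 0 if I does not have as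
    many elements as X has rows. *)
Definition colminor m n (X : 'M[R]_(m, n)) (I : {set 'I_n}) : R :=
  if #|I| =P m is ReflectT e
  then \det (colsub (fun b => enum_val (cast_ord (esym e) b)) X) else 0.

Lemma colminor_card n (I : {set 'I_n}) (X : 'M_(#|I|, n)) :
  colminor X I = \det (colsub enum_val X).
Proof.
rewrite /colminor; case: eqP => // e; congr (\det _).
by apply/matrixP => a b; rewrite !mxE; congr (X _ (enum_val _)); apply/val_inj.
Qed.

Lemma colminor_neq m n (X : 'M_(m, n)) (I : {set 'I_n}) : #|I| != m -> colminor X I = 0.
Proof. by rewrite /colminor; case: eqP. Qed.

Lemma colminorMl m n (T : 'M_m) (X : 'M_(m, n)) (I : {set 'I_n}) :
  colminor (T *m X) I = \det T * colminor X I.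
Proof.
have [e|ne] := eqVneq #|I| m; last by rewrite !colminor_neq ?mulr0.
by subst m; rewrite !colminor_card -det_mulmx -mulmx_colsub.
Qed.

Definition alternating m n (psi : {ffun 'I_m -> 'I_n} -> R) :=
  (forall h : {ffun 'I_m -> 'I_n}, ~~ injectiveb h -> psi h = 0) /\
  (forall (h : {ffun 'I_m -> 'I_n}) (s : 'S_m),
     psi [ffun a => h (s a)] = (-1) ^+ s * psi h).

(** The value of psi at the increasing enumeration of I; up to sign an
    alternating psi takes no other non-zero value at a map with image I. *)
Definition on_set m n (psi : {ffun 'I_m -> 'I_n} -> R) (I : {set 'I_n}) : R :=
  if #|I| =P m is ReflectT e
  then psi [ffun a => enum_val (cast_ord (esym e) a)] else 0.

(** The injective maps in the sum are grouped by their images: those with image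
    I are the permutations of its enumeration, and they add up to a minor. *)
Lemma sum_alternating m n (psi : {ffun 'I_m -> 'I_n} -> R) (X : 'M_(m, n)) :
  alternating psi ->
  \sum_(h : {ffun 'I_m -> 'I_n}) (\prod_a X a (h a)) * psi h =
  \sum_I colminor X I * on_set psi I.
Proof.
rewrite /on_set => -[psi0 psiS].
rewrite (bigID (fun h : {ffun _} => injectiveb h)) /= [X in _ + X]big1 ?addr0; last first.
  by move=> h /psi0->; rewrite mulr0.
rewrite (partition_big (fun h : {ffun 'I_m -> 'I_n} => h @: [set: 'I_m]) predT) //=.
apply: eq_bigr => I _; case: eqP => [e|ne]; last first.
  rewrite mulr0 big1 // => h /andP[/injectiveP injh /eqP hI]; case: ne.
  by rewrite -hI card_imset // cardsT card_ord.
subst m; rewrite colminor_card.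
have -> : [ffun a => enum_val (cast_ord (esym erefl) a)] = [ffun a : 'I_#|I| => enum_val a].
  by apply/ffunP => a; rewrite !ffunE; congr enum_val; apply/val_inj.
pose H (s : 'S_#|I|) := [ffun a => enum_val (s a)] : {ffun 'I_#|I| -> 'I_n}.
have injH : injective H.
  move=> s t /ffunP st; apply/permP => a; have := st a; rewrite !ffunE; exact: enum_val_inj.
rewrite (eq_bigl (fun h => h \in H @: [set: 'S_#|I|])); last first.
  move=> h; apply/andP/imsetP => [[/injectiveP injh /eqP hI]|[s _ ->]]; last first.
    have injs : injective (H s).
      by move=> a b; rewrite !ffunE => /enum_val_inj/perm_inj.
    split; first exact/injectiveP.
    rewrite eqEcard card_imset // cardsT card_ord leqnn andbT.
    by apply/subsetP => _ /imsetP[a _ ->]; rewrite ffunE enum_valP.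
  have hI' a : h a \in I.
    by move/setP/(_ (h a)): hI; rewrite imset_f ?inE // => <-.
  pose f a := enum_rank_in (hI' a) (h a).
  have fK a : enum_val (f a) = h a by rewrite enum_rankK_in.
  have injf : injective f by move=> a b ab; apply: injh; rewrite -!fK ab.
  exists (perm injf); rewrite ?inE //; apply/ffunP => a.
  by rewrite ffunE permE fK.
rewrite big_imset /=; last by move=> s t _ _; exact: injH.
rewrite big_distrl /=; apply: eq_big => [s|s _]; first by rewrite inE.
have -> : H s = [ffun a => [ffun b => enum_val b] (s a)] by apply/ffunP => a; rewrite !ffunE.
rewrite psiS mulrA; congr (_ * _); rewrite mulrC; congr (_ * _).
by apply: eq_bigr => a _; rewrite !mxE !ffunE.
Qed.

Lemma det_col_mx_mul a b n (X : 'M[R]_(a, n)) (Y : 'M_(b, n)) (M N : 'M_(n, a + b)) :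
  \det (col_mx (X *m M) (Y *m N)) =
  \sum_(h : {ffun 'I_a -> 'I_n}) (\prod_i X i (h i)) *
    \sum_(l : {ffun 'I_b -> 'I_n}) (\prod_i Y i (l i)) *
      \det (col_mx (rowsub h M) (rowsub l N)).
Proof.
rewrite /(\det _).
pose F (s : 'S_(a + b)) i j := X i j * M j (s (lshift b i)).
pose G (s : 'S_(a + b)) i j := Y i j * N j (s (rshift a i)).
transitivity (\sum_(s : 'S_(a + b)) (-1) ^+ s *
   ((\sum_(h : {ffun 'I_a -> 'I_n}) \prod_i F s i (h i)) *
    (\sum_(l : {ffun 'I_b -> 'I_n}) \prod_i G s i (l i)))).
  apply: eq_bigr => s _; congr (_ * _).
  rewrite big_split_ord /= -!bigA_distr_bigA; congr (_ * _).
    by apply: eq_bigr => i _; rewrite col_mxEu mxE.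
  by apply: eq_bigr => i _; rewrite col_mxEd mxE.
under eq_bigr do rewrite big_distrl mulr_sumr /=.
rewrite exchange_big /=; apply: eq_bigr => h _.
rewrite mulr_sumr; under eq_bigr do rewrite mulr_sumr mulr_sumr.
rewrite exchange_big /=; apply: eq_bigr => l _.
rewrite !mulr_sumr; apply: eq_bigr => s _.
have -> : \prod_i col_mx (rowsub h M) (rowsub l N) i (s i) =
    (\prod_i M (h i) (s (lshift b i))) * \prod_i N (l i) (s (rshift a i)).
  rewrite big_split_ord; congr (_ * _); apply: eq_bigr => i _.
    by rewrite col_mxEu mxE.
  by rewrite col_mxEd mxE.
by rewrite !big_split /= mulrACA [LHS]mulrCA -[LHS]mulrA.
Qed.

(** The Cauchy-Binet expansion, applied to each of two blocks of rows. *)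
Lemma det_col_mx_colminor a b n (M N : 'M[R]_(n, a + b)) :
  exists kappa : {set 'I_n} -> {set 'I_n} -> R,
  forall (X : 'M_(a, n)) (Y : 'M_(b, n)),
  \det (col_mx (X *m M) (Y *m N)) =
  \sum_I \sum_J kappa I J * colminor X I * colminor Y J.
Proof.
pose psi (h : {ffun 'I_a -> 'I_n}) (l : {ffun 'I_b -> 'I_n}) :=
  \det (col_mx (rowsub h M) (rowsub l N)).
have psiS (h : {ffun 'I_a -> 'I_n}) (l : {ffun 'I_b -> 'I_n}) (s : 'S_a) (t : 'S_b) :
    psi [ffun i => h (s i)] [ffun i => l (t i)] = (-1) ^+ s * (-1) ^+ t * psi h l.
  rewrite /psi -!det_perm -(det_ublock (perm_mx s) 0) -det_mulmx mul_block_col.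
  rewrite !mul0mx addr0 add0r -!row_permE.
  by congr (\det (col_mx _ _)); apply/matrixP => i j; rewrite !mxE ffunE.
have ffunid m (h : {ffun 'I_m -> 'I_n}) : [ffun i => h ((1%g : 'S_m) i)] = h.
  by apply/ffunP => i; rewrite ffunE perm1.
have alt2 h : alternating (psi h).
  split=> [l /injectivePn[i [j ij lij]]|l t].
    rewrite /psi (@determinant_alternate _ _ _ (rshift a i) (rshift a j)) //.
      by rewrite (inj_eq (@rshift_inj _ _)).
    by move=> x; rewrite !col_mxEd !mxE lij.
  by rewrite -{1}(ffunid _ h) psiS odd_perm1 expr0 mul1r.
have alt1 J : alternating (fun h => on_set (psi h) J).
  rewrite /on_set; split=> [h /injectivePn[i [j ij lij]]|h s]; case: eqP => [e|ne]; rewrite ?mulr0 //.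
    rewrite /psi (@determinant_alternate _ _ _ (lshift b i) (lshift b j)) //.
    by move=> x; rewrite !col_mxEu !mxE lij.
  move: [ffun _ => enum_val _] => l.
  by rewrite -{1}(ffunid _ l) psiS odd_perm1 expr0 mulr1.
exists (fun I J => on_set (fun h => on_set (psi h) J) I) => X Y.
rewrite det_col_mx_mul.
under eq_bigr do rewrite (sum_alternating _ (alt2 _)) mulr_sumr.
rewrite exchange_big [in RHS]exchange_big /=; apply: eq_bigr => J _.
under eq_bigr do rewrite mulrCA.
rewrite -mulr_sumr (sum_alternating _ (alt1 J)) mulr_sumr.
by apply: eq_bigr => I _; rewrite mulrC [colminor X I * _]mulrC.
Qed.
End Minors.

Lemma det_neq0_unitmx (k : fieldType) n (A : 'M[k]_n) : (\det A != 0) = (A \in unitmx).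
Proof. by rewrite unitmxE unitfE. Qed.

(** Maximality of the rank of the two blocks together is an open condition, given
    by a determinant.  If a + b <= n, the rows of col_mx S T are free, and M = N
    is a right inverse of this matrix.  If a + b > n, then M and N are chosen with a common
    right inverse L: the matrix of the determinant, multiplied by L, is
    col_mx X Y, which has full column rank as soon as the determinant is
    non-zero. *)
Lemma general_position_detector (k : fieldType) n a b (S : 'M[k]_(a, n)) (T : 'M_(b, n)) :
  row_free S -> row_free T -> \rank (col_mx S T) = minn n (a + b) ->
  exists M N : 'M_(n, a + b),
    \det (col_mx (S *m M) (T *m N)) != 0 /\
    forall (X : 'M_(a, n)) (Y : 'M_(b, n)),
      \det (col_mx (X *m M) (Y *m N)) != 0 -> \rank (col_mx X Y) = minn n (a + b).
Proof.
move=> fS fT rk.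
have [ab|ab] := leqP (a + b) n.
  have /row_freeP[M STM] : row_free (col_mx S T) by rewrite /row_free rk; lia.
  exists M, M; rewrite -!mul_col_mx STM det1 oner_neq0; split=> // X Y.
  rewrite -mul_col_mx det_neq0_unitmx -row_free_unit => /row_freeP[B].
  rewrite -mulmxA => h; have : row_free (col_mx X Y) by apply/row_freeP; exists (M *m B).
  by rewrite /row_free => /eqP->; lia.
have rkn : \rank (col_mx S T) = n by rewrite rk; lia.
(* The rank factorization col_mx S T = X0 *m L, with X0 invertible. *)
pose X0 := col_ebase (col_mx S T).
pose L := pid_mx (\rank (col_mx S T)) *m row_ebase (col_mx S T) : 'M_(a + b, n).
have X0L : X0 *m L = col_mx S T by rewrite /X0 /L mulmxA mulmx_ebase.
have /row_fullP[Z ZL] : row_full L.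
  rewrite /row_full -[L](mulKmx (col_ebase_unit (col_mx S T))) -/X0 X0L.
  by rewrite (eqmxMfull _ (_ : row_full _)) ?rkn // row_full_unit unitmx_inv col_ebase_unit.
case/row_freeP: fS => S' SS'; case/row_freeP: fT => T' TT'.
(* The second summands are killed by S and T, so that the determinant is that of
   X0; they are there to make L a right inverse of M and N. *)
pose M := S' *m usubmx X0 + (1%:M - S' *m S) *m Z.
pose N := T' *m dsubmx X0 + (1%:M - T' *m T) *m Z.
have uL : usubmx X0 *m L = S by rewrite mul_usub_mx X0L col_mxKu.
have dL : dsubmx X0 *m L = T by rewrite mul_dsub_mx X0L col_mxKd.
have SM : S *m M = usubmx X0.
  by rewrite mulmxDr !mulmxA SS' mul1mx mulmxBr mulmxA SS' mul1mx mulmx1 subrr mul0mx addr0.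
have TN : T *m N = dsubmx X0.
  by rewrite mulmxDr !mulmxA TT' mul1mx mulmxBr mulmxA TT' mul1mx mulmx1 subrr mul0mx addr0.
have ML : M *m L = 1%:M by rewrite mulmxDl -!mulmxA uL ZL mulmx1 addrC subrK.
have NL : N *m L = 1%:M by rewrite mulmxDl -!mulmxA dL ZL mulmx1 addrC subrK.
exists M, N; rewrite SM TN vsubmxK det_neq0_unitmx col_ebase_unit; split=> // X Y.
rewrite det_neq0_unitmx => uXY.
have -> : col_mx X Y = col_mx (X *m M) (Y *m N) *m L.
  by rewrite mul_col_mx -!mulmxA ML NL !mulmx1.
rewrite eqmxMfull ?row_full_unit //.
have : row_full L by apply/row_fullP; exists Z.
by rewrite /row_full => /eqP->; lia.
Qed.

(** * Plücker coordinates of a subspace *)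

(** Plücker coordinates are well defined up to a common scalar. *)
Lemma colminor_eqmx (F : fieldType) m1 m2 n (A : 'M[F]_(m1, n)) (B : 'M_(m2, n)) :
  row_free A -> row_free B -> (A :=: B)%MS ->
  exists2 c, c != 0 & forall I, colminor A I = c * colminor B I.
Proof.
move=> fA fB AB; have E : m1 = m2 by rewrite -(eqP fA) -(eqP fB) AB.
subst m2; have /submxP[T AT] : (A <= B)%MS by rewrite AB.
exists (\det T); last by move=> I; rewrite AT colminorMl.
rewrite det_neq0_unitmx -row_free_unit.
by move: fA; rewrite {1}AT /row_free mxrankMfree.
Qed.

Section Plucker.
Variables (k : closedFieldType) (V : vectType k).
Local Notation r := (\dim {:V}).
Local Notation e := (vbasis {:V}).
Implicit Types U W : {vspace V}.

Let eB : basis_of {:V} e := vbasisP {:V}.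

Definition row_basis m (X : 'M[k]_(m, r)) U :=
  row_free X /\ forall v, (rVof e v <= X)%MS = (v \in U).

Definition coordmx m (s : seq V) : 'M[k]_(m, r) := \matrix_(a, j) coord e j s`_a.

Lemma mul_coordmx m s (u : 'rV_m) :
  u *m coordmx m s = rVof e (\sum_a u 0 a *: s`_a).
Proof.
apply/rowP => j; rewrite !mxE linear_sum; apply: eq_bigr => a _.
by rewrite !mxE linearZ.
Qed.

Lemma row_basis_coordmx (s : seq V) m U : size s = m -> basis_of U s ->
  row_basis (coordmx m s) U.
Proof.
move=> <- bs; split.
  rewrite -kermx_eq0; apply/rowV0P => u /sub_kermxP.
  rewrite mul_coordmx => /eqP; rewrite rVof_eq0 // => /eqP u0.
  have /freeP/(_ _ u0) u0' : free (in_tuple s) by exact: basis_free bs.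
  by apply/rowP => a; rewrite mxE u0'.
move=> v; rewrite -(span_basis bs); apply/submxP/idP => [[u]|/(coord_span (X := in_tuple s)) vE].
  rewrite mul_coordmx => /(can_inj (rVofK eB)) ->.
  by apply: memv_suml => a _; apply/memvZ/memv_span/mem_nth.
exists (\row_a coord (in_tuple s) a v); rewrite mul_coordmx {1}vE.
by congr (rVof _ _); apply: eq_bigr => a _; rewrite mxE.
Qed.

Lemma row_basis_eqmx m1 m2 (X : 'M_(m1, r)) (Y : 'M_(m2, r)) U :
  row_basis X U -> row_basis Y U -> (X :=: Y)%MS.
Proof.
move=> [_ XU] [_ YU]; apply/eqmxP/andP; split; apply/rV_subP => u.
  by rewrite -[u](vecofK eB) XU YU.
by rewrite -[u](vecofK eB) XU YU.
Qed.

Lemma row_basis_rank_add m1 m2 (X : 'M_(m1, r)) (Y : 'M_(m2, r)) U W :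
  row_basis X U -> row_basis Y W -> \rank (col_mx X Y) = \dim (U + W).
Proof.
move=> [_ XU] [_ YW].
have [fZ ZUW] := row_basis_coordmx (size_tuple _) (vbasisP (U + W)%VS).
rewrite -(eqP fZ); apply/eqmx_rank/andP; split; apply/rV_subP => u.
  rewrite -[u](vecofK eB) ZUW -addsmxE => /sub_addsmxP[[u1 u2] /= uE].
  have : (u1 *m X <= X)%MS by exact: submxMl.
  have : (u2 *m Y <= Y)%MS by exact: submxMl.
  rewrite -[u1 *m X](vecofK eB) -[u2 *m Y](vecofK eB) XU YW => u2W u1U.
  have -> : vecof e u = vecof e (u1 *m X) + vecof e (u2 *m Y).
    by rewrite -raddfD /= -uE vecofK.
  exact: memv_add.
rewrite -[u](vecofK eB) ZUW => /memv_addP[u1 u1U [u2 u2W ->]].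
by rewrite raddfD /= -addsmxE addmx_sub_adds ?XU ?YW.
Qed.

(** The number m of rows is separate from \dim U, so that subspaces of the same
    dimension give matrices of the same type. *)
Lemma plucker_row_basis_exists U m : \dim U = m ->
  exists2 X : 'M_(m, r), row_basis X U & forall I, plucker U I = colminor X I.
Proof.
move=> <-; exists (coordmx (\dim U) (vbasis U)).
  exact: row_basis_coordmx (size_tuple _) (vbasisP U).
move=> I; rewrite /plucker; move: (\dim U) (tval (vbasis U)) => m' s.
have [E|ne] := eqVneq #|I| m'; last by rewrite colminor_neq.
subst m'; rewrite colminor_card; congr (\det _).
by apply/matrixP => a b; rewrite !mxE.
Qed.

Lemma row_basis_img m (X : 'M_(m, r)) U (g : 'End(V)) : lker g == 0%VS ->
  row_basis X U -> row_basis (X *m mxof e e g) (g @: U)%VS.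
Proof.
move=> kg [fX XU].
have fg : row_free (mxof e e g).
  by rewrite -kermx_eq0 -(vsof_eq0 eB) -lker_ker.
split; first by rewrite /row_free mxrankMfree.
move=> v; apply/submxP/memv_imgP => [[u]|[w wU ->]].
  rewrite mulmxA => uE; have : (u *m X <= X)%MS by exact: submxMl.
  rewrite -[u *m X](vecofK eB) XU => uU; exists (vecof e (u *m X)) => //.
  by apply: (can_inj (rVofK eB)); rewrite uE (rVof_app _ eB) vecofK // mulmxA.
move: wU; rewrite -XU => /submxP[u uE]; exists u.
by rewrite mulmxA -uE (rVof_app _ eB).
Qed.

(** The coordinates of the image are computed from a basis of U, which makes
    their dependence on g polynomial. *)
Lemma plucker_img U (g : 'End(V)) : lker g == 0%VS ->
  exists2 c, c != 0 & forall I,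
    plucker (g @: U)%VS I = c * colminor (coordmx (\dim U) (vbasis U) *m mxof e e g) I.
Proof.
move=> kg.
have [X XgU pX] := plucker_row_basis_exists (erefl (\dim (g @: U))).
have YgU := row_basis_img kg (row_basis_coordmx (size_tuple _) (vbasisP U)).
have [c c0 cE] := colminor_eqmx XgU.1 YgU.1 (row_basis_eqmx XgU YgU).
by exists c => // I; rewrite pX cE.
Qed.

Lemma plucker_detector a b U W : \dim U = a -> \dim W = b ->
  \dim (U + W) = minn r (a + b) ->
  exists kappa : {set 'I_r} -> {set 'I_r} -> k,
    \sum_I \sum_J kappa I J * plucker U I * plucker W J != 0 /\
    forall U' W', \dim U' = a -> \dim W' = b ->
      \sum_I \sum_J kappa I J * plucker U' I * plucker W' J != 0 ->
      \dim (U' + W') = minn r (a + b).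
Proof.
move=> dU dW dUW.
have [X XU pX] := plucker_row_basis_exists dU.
have [Y YW pY] := plucker_row_basis_exists dW.
have [|M [N [nz MN]]] := general_position_detector XU.1 YW.1.
  by rewrite (row_basis_rank_add XU YW).
have [kappa kE] := det_col_mx_colminor M N; exists kappa; split.
  by move: nz; rewrite kE; under eq_bigr do under eq_bigr do rewrite -pX -pY.
move=> U' W' dU' dW'.
have [X' XU' pX'] := plucker_row_basis_exists dU'.
have [Y' YW' pY'] := plucker_row_basis_exists dW'.
under eq_bigr do under eq_bigr do rewrite pX' pY'.
by rewrite -kE -(row_basis_rank_add XU' YW'); exact: MN.
Qed.
End Plucker.

(** * Multihomogeneous polynomials and flags *)

Section Multihomogeneous.
Variables (k : closedFieldType) (V : vectType k) (n : nat).
Local Notation r := (\dim {:V}).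
Local Notation pvar := (pvar V n).
Local Notation N := #|{: pvar}|.

Definition factor_degree (c : factor n) (m : 'X_{1..N}) : nat :=
  (\sum_(I : {set 'I_r}) m (enum_rank ((c, I) : pvar)))%N.

Lemma factor_degree0 c : factor_degree c 0%MM = 0%N.
Proof. by rewrite /factor_degree big1 // => I _; rewrite mnm0E. Qed.

Lemma factor_degreeD c : {morph factor_degree c : m1 m2 / (m1 + m2)%MM >-> (m1 + m2)%N}.
Proof.
by move=> m1 m2; rewrite /factor_degree -big_split; apply: eq_bigr => I _; rewrite mnmDE.
Qed.

HB.instance Definition _ c :=
  isMeasure.Build N (factor_degree c) (factor_degree0 c) (factor_degreeD c).

Lemma multihomogeneousP (P : {mpoly k[N]}) :
  multihomogeneous P <-> forall c, exists d, P \is d.-homog for (factor_degree c).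
Proof.
split=> hP c; have [d dP] := hP c; exists d.
  by rewrite dhomogE; apply/allP => m /dP/eqP.
by move=> m mP; move: dP; rewrite dhomogE => /allP/(_ m mP)/eqP.
Qed.

Lemma multihomogeneous1 : multihomogeneous (1 : {mpoly k[N]}).
Proof. by apply/multihomogeneousP => c; exists 0%N; apply: dhomog1. Qed.

Lemma multihomogeneousM (P Q : {mpoly k[N]}) :
  multihomogeneous P -> multihomogeneous Q -> multihomogeneous (P * Q).
Proof.
move=> /multihomogeneousP hP /multihomogeneousP hQ; apply/multihomogeneousP => c.
have [d dP] := hP c; have [d' dQ] := hQ c.
by exists (d + d')%N; apply: dhomogM.
Qed.

(** Each factor has its own homogeneous coordinates, hence the separate scalars. *)
Lemma meval_rescale (P : {mpoly k[N]}) (s : factor n -> k) : multihomogeneous P ->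
  (forall c, s c != 0) ->
  exists2 u, u != 0 & forall v : pvar -> k,
    P.@[fun x => s (enum_val x).1 * v (enum_val x)] = u * P.@[fun x => v (enum_val x)].
Proof.
move=> hP s0; have [d dP] := fin_all_exists hP.
exists (\prod_c s c ^+ d c).
  by apply/prodf_neq0 => c _; apply: expf_neq0.
move=> v; rewrite !mevalE mulr_sumr big_seq [RHS]big_seq.
apply: eq_bigr => m mP; rewrite [RHS]mulrCA; congr (_ * _).
under eq_bigr do rewrite exprMn.
rewrite big_split /=; congr (_ * _).
rewrite (reindex (fun x : pvar => enum_rank x)) /=; last first.
  by exists enum_val => x _; [apply: enum_rankK | apply: enum_valK].
under eq_bigr do rewrite enum_rankK.
have -> : \prod_(x : pvar) s x.1 ^+ m (enum_rank x) =
    \prod_c \prod_I s c ^+ m (enum_rank ((c, I) : pvar)).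
  by rewrite pair_bigA; apply: eq_bigr => -[].
apply: eq_bigr => c _; rewrite prodrXr; congr (_ ^+ _); exact: dP.
Qed.

Definition bilinear_pluckers (c c' : factor n) (kappa : {set 'I_r} -> {set 'I_r} -> k) :
    {mpoly k[N]} :=
  \sum_I \sum_J kappa I J *: ('X_(enum_rank ((c, I) : pvar)) * 'X_(enum_rank ((c', J) : pvar))).

Lemma multihomogeneous_bilinear_pluckers c c' kappa :
  multihomogeneous (bilinear_pluckers c c' kappa).
Proof.
have deg1 b c0 (I : {set 'I_r}) :
    factor_degree b U_(enum_rank ((c0, I) : pvar))%MM = (c0 == b).
  rewrite /factor_degree (bigD1 I) //= mnm1E (inj_eq enum_rank_inj) xpair_eqE eqxx andbT.
  rewrite big1 ?addn0 // => J /negbTE JI.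
  by rewrite mnm1E (inj_eq enum_rank_inj) xpair_eqE [I == J]eq_sym JI andbF.
apply/multihomogeneousP => b; exists ((c == b) + (c' == b))%N.
apply: rpred_sum => I _; apply: rpred_sum => J _; apply: rpredZ.
by apply: dhomogM; rewrite dhomogX; apply/eqP; apply: deg1.
Qed.

Lemma meval_bilinear_pluckers c c' kappa (v : pvar -> k) :
  (bilinear_pluckers c c' kappa).@[fun x => v (enum_val x)] =
  \sum_I \sum_J kappa I J * v (c, I) * v (c', J).
Proof.
rewrite raddf_sum /=; apply: eq_bigr => I _; rewrite raddf_sum /=; apply: eq_bigr => J _.
by rewrite mevalZ mevalM !mevalXU !enum_rankK mulrA.
Qed.
End Multihomogeneous.

Section Flags.
Variables (k : closedFieldType) (V : vectType k) (n : nat).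
Local Notation r := (\dim {:V}).
Local Notation flag := (flag V n).
Implicit Types f h : flag.

Lemma chain_step f : chain n (step f).
Proof.
case: f => s sf; have /and3P[/eqP s0 /eqP sn ss] := sf; rewrite /step /=; split.
- by rewrite nth0.
- by rewrite -sn (last_nth 0%VS) /= size_tuple; case: (tval s) (size_tuple s).
- move=> i j /andP[ij jn].
  apply: (sorted_leq_nth (@subv_trans _ _) (@subvv _ _) 0%VS ss) => //.
    by rewrite inE size_tuple ltnS (leq_trans ij).
  by rewrite inE size_tuple ltnS.
Qed.

Lemma flag_of_chain P : chain n P -> exists f, forall i, (i <= n)%N -> step f i = P i.
Proof.
move=> cP; pose s := [tuple of mkseq P n.+1].
have sf : is_flag s.
  apply/and3P; split.
  - by rewrite /= (chain0 cP).
  - have <- := chainT cP.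
    by rewrite -[tval s]/(mkseq P n.+1) -nth_last size_mkseq nth_mkseq.
  - apply/(sortedP 0%VS) => i; rewrite size_mkseq => iN.
    rewrite !nth_mkseq //; last exact: ltnW.
    by apply: (chain_le cP); lia.
exists (exist _ s sf) => i iN; rewrite /step /=; exact: (nth_mkseq 0%VS P (n := n.+1)).
Qed.

Lemma flag_img (g : 'End(V)) f : lker g == 0%VS ->
  exists h, forall i, (i <= n)%N -> step h i = (g @: step f i)%VS.
Proof.
move=> kg; apply: flag_of_chain; have cf := chain_step f; split.
- by rewrite (chain0 cf) limg0.
- by rewrite (chainT cf) lker0_limgf.
- by move=> i j ij; apply/limgS/(chain_le cf).
Qed.
End Flags.

(** * Pairs of flags in general position *)

Local Open Scope classical_set_scope.

Section GenericPairs.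
Variables (k : closedFieldType) (V : vectType k) (n : nat).
Local Notation r := (\dim {:V}).
Local Notation flag := (flag V n).
Local Notation D := (D n r).
Implicit Types (f h : flag) (p q : flag * flag) (d e : D).

Definition cumul d (i : nat) : nat := (\sum_(j < n | (j < i)%N) (val d j : nat))%N.

Lemma cumul0 d : cumul d 0 = 0%N.
Proof. by rewrite /cumul big_pred0. Qed.

Lemma cumulS d (j : 'I_n) : cumul d j.+1 = (cumul d j + val d j)%N.
Proof.
rewrite /cumul (bigD1 j) //= addnC; congr (_ + _)%N; apply: eq_bigl => i.
by rewrite ltnS [RHS]ltn_neqAle andbC.
Qed.

Lemma cumuln d : cumul d n = r.
Proof.
rewrite -(eqP (valP d)); apply: eq_bigl => j; exact: ltn_ord.
Qed.

Lemma leq_cumul d i j : (i <= j)%N -> (cumul d i <= cumul d j)%N.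
Proof.
move=> ij; rewrite /cumul big_mkcond [leqRHS]big_mkcond; apply: leq_sum => l _.
by case: ifP => // li; rewrite (leq_trans li ij).
Qed.

(** Types recorded by the dimensions of the steps rather than by their
    differences. *)
Lemma flags_of_typeP d f :
  flags_of_type d f <-> forall i, (i <= n)%N -> \dim (step f i) = cumul d i.
Proof.
have cf := chain_step f; split=> [df i|df i].
  elim: i => [_|i IH iN]; first by rewrite (chain0 cf) dimv0 cumul0.
  have := dimvS (chain_le cf (i := i) (j := i.+1) _); rewrite leqnSn iN => /(_ isT).
  by have := df (Ordinal iN); rewrite (cumulS d (Ordinal iN)) -IH ?(ltnW iN) //= => <-; lia.
by rewrite !df ?(ltnW (ltn_ord i)) // cumulS addKn.
Qed.

Lemma flags_of_type_inj d e f : flags_of_type d f -> flags_of_type e f -> d = e.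
Proof.
move=> df ef; apply/val_inj/ffunP => i; apply/val_inj.
by rewrite /= -[LHS]df -[RHS]ef.
Qed.

Lemma chain_basis d (X : seq V) : basis_of fullv X ->
  chain n (fun i => <<take (cumul d i) X>>%VS).
Proof.
move=> bX; split.
- by rewrite cumul0 take0 span_nil.
- by rewrite cumuln take_oversize ?(basis_of_full_size bX) // (span_basis bX).
- move=> i j /andP[ij _]; apply: sub_span => x.
  by rewrite -(take_takel X (leq_cumul d ij)) => /mem_take.
Qed.

Lemma dim_span_take (X : seq V) a : basis_of fullv X -> (a <= r)%N -> \dim <<take a X>> = a.
Proof.
move=> bX ar; have := dim_take_drop bX ar (leq0n r).
rewrite subn0 drop_oversize ?(basis_of_full_size bX) // span_nil addv0 => ->; lia.
Qed.

Lemma cumul_le_dim d i : (i <= n)%N -> (cumul d i <= r)%N.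
Proof. by move=> /(leq_cumul d); rewrite cumuln. Qed.

Lemma flag_of_basis d (X : seq V) : basis_of fullv X ->
  exists f, flags_of_type d f /\ forall i, (i <= n)%N -> step f i = <<take (cumul d i) X>>%VS.
Proof.
move=> bX; have [f fE] := flag_of_chain (chain_basis d bX).
exists f; split=> //; apply/flags_of_typeP => i iN.
by rewrite fE // dim_span_take // cumul_le_dim.
Qed.

Definition generic_pairs d e : set (flag * flag) :=
  [set p | [/\ flags_of_type d p.1, flags_of_type e p.2 &
               in_general_position n n (step p.1) (step p.2)]].

Lemma basis_of_rev (X : seq V) : basis_of fullv X -> basis_of fullv (rev X).
Proof. by rewrite (@perm_basis _ _ (rev X) X) // perm_rev. Qed.

Lemma generic_pair_of_basis d e (X : seq V) f h : basis_of fullv X ->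
  (forall i, (i <= n)%N -> step f i = <<take (cumul d i) X>>%VS) ->
  (forall i, (i <= n)%N -> step h i = <<take (cumul e i) (rev X)>>%VS) ->
  generic_pairs d e (f, h).
Proof.
move=> bX fE hE; have bX' := basis_of_rev bX.
split=> /=.
- by apply/flags_of_typeP => i iN; rewrite fE ?dim_span_take ?cumul_le_dim.
- by apply/flags_of_typeP => i iN; rewrite hE ?dim_span_take ?cumul_le_dim.
- move=> i j iN jN; rewrite fE // hE // !dim_span_take ?cumul_le_dim //.
  have -> : <<take (cumul e j) (rev X)>>%VS = <<drop (r - cumul e j) X>>%VS.
    by rewrite take_rev (basis_of_full_size bX); apply: eq_span => x; rewrite mem_rev.
  by rewrite dim_take_drop ?cumul_le_dim.
Qed.

Lemma generic_pairs_nonempty d e : generic_pairs d e !=set0.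
Proof.
have bX := vbasisP {:V}.
have bX' := basis_of_rev bX.
have [f [_ fE]] := flag_of_basis d bX; have [h [_ hE]] := flag_of_basis e bX'.
by exists (f, h); apply: generic_pair_of_basis bX fE hE.
Qed.

Lemma generic_pairs_adapted d e p : generic_pairs d e p ->
  exists X : seq V, [/\ basis_of fullv X,
    forall i, (i <= n)%N -> step p.1 i = <<take (cumul d i) X>>%VS &
    forall i, (i <= n)%N -> step p.2 i = <<drop (r - cumul e i) X>>%VS].
Proof.
case=> /flags_of_typeP dp /flags_of_typeP ep gp.
have [X [bX X1 X2]] := adapted_basis (chain_step p.1) (chain_step p.2) gp.
exists X; split=> // i iN; first by rewrite {1}X1 // dp.
by rewrite {1}X2 // ep.
Qed.

Lemma generic_pairs_orbit d e p : generic_pairs d e p -> gl_orbit p = generic_pairs d e.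
Proof.
move=> gp; have [dp ep pp] := gp; rewrite predeqE => q; split=> [[g kg gq]|gq].
  have dg U : \dim (g @: U) = \dim U by rewrite limg_dim_eq // (eqP kg) capv0.
  split.
  - by apply/flags_of_typeP => i iN; rewrite (gq i iN).1 dg; move/flags_of_typeP: dp; apply.
  - by apply/flags_of_typeP => i iN; rewrite (gq i iN).2 dg; move/flags_of_typeP: ep; apply.
  - by move=> i j iN jN; rewrite (gq i iN).1 (gq j jN).2 -limgD !dg pp.
have [X [bX X1 X2]] := generic_pairs_adapted gp.
have [Y [bY Y1 Y2]] := generic_pairs_adapted gq.
have [g kg gXY] := lker0_move_basis bX bY.
exists g => // i iN; rewrite X1 // X2 // Y1 // Y2 // !limg_span.
by rewrite map_take map_drop gXY.
Qed.

Definition meet_dim p i j := \dim (step p.1 i :&: step p.2 j)%VS.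

Lemma meet_dim0l p j : meet_dim p 0 j = 0%N.
Proof. by rewrite /meet_dim (chain0 (chain_step _)) cap0v dimv0. Qed.

Lemma meet_dim0r p i : meet_dim p i 0 = 0%N.
Proof. by rewrite /meet_dim (chain0 (chain_step p.2)) capv0 dimv0. Qed.

Lemma meet_dimnl p j : meet_dim p n j = \dim (step p.2 j).
Proof. by rewrite /meet_dim (chainT (chain_step _)) capfv. Qed.

Lemma meet_dimnr p i : meet_dim p i n = \dim (step p.1 i).
Proof. by rewrite /meet_dim (chainT (chain_step p.2)) capvf. Qed.

(** The subspace step p.1 i.+1 :&: step p.2 j meets step p.1 i in
    step p.1 i :&: step p.2 j, so each term of the entry is, up to the common
    summand \dim (step p.1 i), a difference of dimensions of intersections;
    subtractions are moved across the equality. *)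
Lemma rel_entry_meet_dim p i j : (i < n)%N -> (j < n)%N ->
  (rel_entry p i j + meet_dim p i.+1 j + meet_dim p i j.+1 =
   meet_dim p i.+1 j.+1 + meet_dim p i j)%N.
Proof.
move=> iN jN; have le1 : (step p.1 i <= step p.1 i.+1)%VS.
  by apply: (chain_le (chain_step _)); rewrite leqnSn.
have le2 : (step p.2 j <= step p.2 j.+1)%VS.
  by apply: (chain_le (chain_step _)); rewrite leqnSn.
have E l : (\dim (step p.1 i + (step p.1 i.+1 :&: step p.2 l))%VS + meet_dim p i l =
    \dim (step p.1 i) + meet_dim p i.+1 l)%N.
  by rewrite /meet_dim -[RHS]dimv_sum_cap capvA (capv_idPl le1).
have := dimvS (addvS (subvv (step p.1 i)) (capvS (subvv (step p.1 i.+1)) le2)).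
by have := E j; have := E j.+1; rewrite /rel_entry; lia.
Qed.

(** The entries are second differences of the meet dimensions, which vanish at
    the index 0, so each family determines the other. *)
Lemma rel_entry_eqP p q :
  (forall i j, (i < n)%N -> (j < n)%N -> rel_entry p i j = rel_entry q i j) <->
  (forall i j, (i <= n)%N -> (j <= n)%N -> meet_dim p i j = meet_dim q i j).
Proof.
split=> [pq|pq] i j.
  elim: i j => [|i IHi] j iN; first by rewrite !meet_dim0l.
  elim: j => [|j IHj] jN; first by rewrite !meet_dim0r.
  have := rel_entry_meet_dim p iN jN; have := rel_entry_meet_dim q iN jN.
  rewrite pq // IHj ?(ltnW jN) // !IHi ?(ltnW iN) ?(ltnW jN) //; lia.
move=> iN jN; have := rel_entry_meet_dim p iN jN; have := rel_entry_meet_dim q iN jN.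
by rewrite !pq ?(ltnW iN) ?(ltnW jN) //; lia.
Qed.

Lemma sum_rel_entry p : (\sum_(i < n) \sum_(j < n) rel_entry p i j = r)%N.
Proof.
have row i : (i < n)%N -> forall m, (m <= n)%N ->
    (\sum_(j < m) rel_entry p i j + meet_dim p i m = meet_dim p i.+1 m)%N.
  move=> iN; elim=> [|m IH] mN; first by rewrite big_ord0 !meet_dim0r.
  have := rel_entry_meet_dim p iN mN; have := IH (ltnW mN); rewrite big_ord_recr /=; lia.
have tot m : (m <= n)%N -> (\sum_(i < m) \sum_(j < n) rel_entry p i j = meet_dim p m n)%N.
  elim: m => [|m IH] mN; first by rewrite big_ord0 meet_dim0l.
  by rewrite big_ord_recr /= IH ?(ltnW mN) // -(row m mN n) // addnC.
by rewrite tot // meet_dimnr (chainT (chain_step _)).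
Qed.

Lemma theta_of_pair p : exists A : Theta n r, forall i j : 'I_n, val A i j = rel_entry p i j :> nat.
Proof.
pose B : 'M['I_r.+1]_n := \matrix_(i, j) inord (rel_entry p i j).
have BE i j : B i j = rel_entry p i j :> nat.
  by rewrite mxE inordK // ltnS (leq_trans (leq_subr _ _)) // dim_le_full.
have sB : (\sum_i \sum_j (B i j : nat) == r)%N.
  by under eq_bigr do under eq_bigr do rewrite BE; rewrite sum_rel_entry.
by exists (exist _ B sB).
Qed.

(** Both sides are described by the dimensions of the intersections: on generic
    pairs these are determined by d and e, and conversely they give back the
    types, as intersections with the last step, and then general position. *)
Lemma orbit_of_generic_pairs d e :
  exists A : Theta n r, orbit_of A = generic_pairs d e.
Proof.
have [p gp] := generic_pairs_nonempty d e; have [A AE] := theta_of_pair p.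
have gm q : generic_pairs d e q <->
    forall i j, (i <= n)%N -> (j <= n)%N ->
      meet_dim q i j = (cumul d i + cumul e j - minn r (cumul d i + cumul e j))%N.
  split=> [[/flags_of_typeP dq /flags_of_typeP eq gq] i j iN jN|H].
    by have := dimv_sum_cap (step q.1 i) (step q.2 j); rewrite gq // dq // eq // /meet_dim; lia.
  have dq i : (i <= n)%N -> \dim (step q.1 i) = cumul d i.
    by move=> iN; rewrite -meet_dimnr H // cumuln; have := cumul_le_dim d iN; lia.
  have eq i : (i <= n)%N -> \dim (step q.2 i) = cumul e i.
    by move=> iN; rewrite -meet_dimnl H // cumuln; have := cumul_le_dim e iN; lia.
  split; [exact/flags_of_typeP | exact/flags_of_typeP | move=> i j iN jN].
  have := dimv_sum_cap (step q.1 i) (step q.2 j); have := H i j iN jN.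
  rewrite /meet_dim dq // eq //; lia.
have om q : orbit_of A q <->
    (forall i j, (i < n)%N -> (j < n)%N -> rel_entry q i j = rel_entry p i j).
  split=> [H i j iN jN|H i j]; last by rewrite AE H.
  by rewrite -(AE (Ordinal iN) (Ordinal jN)) -H.
move/gm: gp => gp; exists A; rewrite predeqE => q.
split=> [/om/rel_entry_eqP H|/gm H].
  by apply/gm => i j iN jN; rewrite H // gp.
by apply/om/rel_entry_eqP => i j iN jN; rewrite H // gp.
Qed.
End GenericPairs.

(** * Open conditions and segments of endomorphisms *)

Section Zariski.
Variables (k : closedFieldType) (V : vectType k) (n : nat).
Local Notation r := (\dim {:V}).
Local Notation flag := (flag V n).
Local Notation D := (D n r).
Local Notation pvar := (pvar V n).
Local Notation N := #|{: pvar}|.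
Local Notation e := (vbasis {:V}).
Implicit Types (p q : flag * flag) (P Q : {mpoly k[N]}) (d : D) (g : 'End(V)).

Definition pair_eval P p : k := P.@[fun x => plucker_pair p (enum_val x)].

(** The polynomial is the product over all (i, j) of the bilinear forms that
    detect general position of the i-th and the j-th step near p. *)
Lemma generic_pairs_open d (d' : D) p : generic_pairs d d' p ->
  exists P, [/\ multihomogeneous P, pair_eval P p != 0 &
    forall q, flags_of_type d q.1 -> flags_of_type d' q.2 ->
      pair_eval P q != 0 -> generic_pairs d d' q].
Proof.
case=> /flags_of_typeP dp /flags_of_typeP dp' gp.
have ordN (i : 'I_n.+1) : (i <= n)%N by rewrite -ltnS.
have gp' (ij : 'I_n.+1 * 'I_n.+1) : \dim (step p.1 ij.1 + step p.2 ij.2) =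
    minn r (cumul d ij.1 + cumul d' ij.2) by rewrite gp // dp // dp'.
have [kappa kE] := fin_all_exists (fun ij : 'I_n.+1 * 'I_n.+1 =>
  plucker_detector (dp _ (ordN ij.1)) (dp' _ (ordN ij.2)) (gp' ij)).
pose F (ij : 'I_n.+1 * 'I_n.+1) : {mpoly k[N]} :=
  bilinear_pluckers (false, ij.1) (true, ij.2) (kappa ij).
have FE q ij : pair_eval (F ij) q = \sum_I \sum_J
    kappa ij I J * plucker (step q.1 ij.1) I * plucker (step q.2 ij.2) J.
  exact: meval_bilinear_pluckers.
have PE q : pair_eval (\prod_ij F ij) q = \prod_ij pair_eval (F ij) q by exact: rmorph_prod.
exists (\prod_ij F ij); split.
- apply: (big_ind (fun P => multihomogeneous P)).
  + exact: multihomogeneous1.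
  + exact: multihomogeneousM.
  + by move=> ij _; apply: multihomogeneous_bilinear_pluckers.
- by rewrite PE; apply/prodf_neq0 => ij _; rewrite FE; case: (kE ij).
move=> q dq dq'; rewrite PE => /prodf_neq0 Fq; split=> // i j iN jN.
move/flags_of_typeP: dq => dq; move/flags_of_typeP: dq' => dq'.
have [_ /(_ (step q.1 i) (step q.2 j))] := kE (Ordinal (iN : (i < n.+1)%N), Ordinal (jN : (j < n.+1)%N)).
rewrite /= !dq // !dq' //; apply=> //.
by have := Fq (Ordinal (iN : (i < n.+1)%N), Ordinal (jN : (j < n.+1)%N)) isT; rewrite FE.
Qed.

Definition segment g (t : k) : 'End(V) := (1 - t) *: \1%VF + t *: g.

(** The matrix of the segment with the parameter as the indeterminate. *)
Definition segment_mx g : 'M[{poly k}]_r :=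
  (1 - 'X)%:M + 'X *: map_mx polyC (mxof e e g).

Lemma mxof_segment g t : mxof e e (segment g t) = map_mx (horner_eval t) (segment_mx g).
Proof.
rewrite /segment linearD !linearZ /= mxof1 ?(basis_free (vbasisP _)) //.
rewrite map_mxD map_mxZ map_scalar_mx /= scalemx1.
by apply/matrixP => i j; rewrite !mxE /horner_eval !hornerE.
Qed.

Lemma segment0 g : segment g 0 = \1%VF.
Proof. by rewrite /segment subr0 scale1r scale0r addr0. Qed.

Lemma segment1 g : segment g 1 = g.
Proof. by rewrite /segment subrr scale1r scale0r add0r. Qed.

Definition segment_det g : {poly k} := \det (segment_mx g).

Lemma lker_segment g t : (lker (segment g t) == 0%VS) = ((segment_det g).[t] != 0).
Proof.
rewrite (lker_ker (vbasisP _)) vsof_eq0 ?vbasisP // kermx_eq0 row_free_unit.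
rewrite -det_neq0_unitmx mxof_segment; congr (_ != _).
by rewrite -horner_evalE /segment_det -det_map_mx.
Qed.

(** At 0 the segment passes through the identity. *)
Lemma segment_det_neq0 g : segment_det g != 0.
Proof.
apply/negP => /eqP g0; have := lker_segment g 0; rewrite g0 horner0 eqxx segment0.
move=> /negbT/negP; apply; apply/eqP/vspaceP => v.
by rewrite memv_ker id_lfunE memv0.
Qed.

Definition moved_by (g g' : 'End(V)) p q :=
  forall i, (i <= n)%N -> step q.1 i = (g @: step p.1 i)%VS /\
                          step q.2 i = (g' @: step p.2 i)%VS.

Definition segment_pluckers p g g' (x : pvar) : {poly k} :=
  let U := step (if x.1.1 then p.2 else p.1) x.1.2 in
  colminor (map_mx polyC (coordmx (\dim U) (vbasis U)) *m
            segment_mx (if x.1.1 then g' else g)) x.2.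

Definition segment_eval P p g g' : {poly k} :=
  \sum_(m <- msupp P) (P@_m)%:P * \prod_x segment_pluckers p g g' (enum_val x) ^+ m x.

(** Restricted to a segment of pairs of flags, the vanishing of a multihomogeneous
    polynomial is that of a polynomial in one variable. *)
Lemma horner_segment_eval P p q g g' t :
  multihomogeneous P -> lker (segment g t) == 0%VS -> lker (segment g' t) == 0%VS ->
  moved_by (segment g t) (segment g' t) p q ->
  ((segment_eval P p g g').[t] == 0) = (pair_eval P q == 0).
Proof.
move=> hP kg kg' pq.
have colmE m (X : 'M[{poly k}]_(m, r)) I :
    (colminor X I).[t] = colminor (map_mx (horner_eval t) X) I.
  rewrite /colminor; case: eqP => [E|_]; last exact: horner0.
  by rewrite -horner_evalE -det_map_mx; congr (\det _); apply/matrixP => a b; rewrite !mxE.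
have scal (c : factor n) : exists a : k, a != 0 /\ forall I,
    plucker_pair q (c, I) = a * (segment_pluckers p g g' (c, I)).[t].
  case: c => b i.
  have iN : (i <= n)%N by rewrite -ltnS.
  have [q1 q2] := pq i iN.
  have kb : lker (segment (if b then g' else g) t) == 0%VS by case: b.
  have [c c0 cE] := plucker_img (step (if b then p.2 else p.1) i) kb.
  exists c; split=> // I; rewrite /plucker_pair /segment_pluckers /=.
  have -> : step (if b then q.2 else q.1) i =
      (segment (if b then g' else g) t @: step (if b then p.2 else p.1) i)%VS.
    by case: b {kb cE}.
  rewrite cE colmE map_mxM mxof_segment; congr (_ * colminor (_ *m _) _).
  by apply/matrixP => a j; rewrite !mxE /= horner_evalE hornerC.
have [s sE] := fin_all_exists scal.
have s0 c : s c != 0 by case: (sE c).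
have [u u0 uE] := meval_rescale hP s0.
have -> : pair_eval P q = u * (segment_eval P p g g').[t].
  rewrite /segment_eval horner_sum.
  transitivity (u * P.@[fun x => (segment_pluckers p g g' (enum_val x)).[t]]).
    rewrite -(uE (fun x => (segment_pluckers p g g' x).[t])).
    apply: meval_eq => x; case: (enum_val x) => c I; by case: (sE c) => _ ->.
  congr (_ * _); rewrite mevalE; apply: eq_bigr => m _.
  rewrite hornerM hornerC horner_prod; congr (_ * _); apply: eq_bigr => x _.
  by rewrite horner_exp.
by rewrite mulf_eq0 (negbTE u0).
Qed.
End Zariski.

(** * Density of the generic orbit *)

Section Density.
Variables (k : closedFieldType) (V : vectType k) (n : nat).
Local Notation r := (\dim {:V}).
Local Notation flag := (flag V n).
Local Notation D := (D n r).
Implicit Types (f h : flag) (p q : flag * flag) (d e : D) (g : 'End(V)).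

(** Every flag is in general position with the chain from 0 to the whole space. *)
Lemma flag_adapted d f : flags_of_type d f ->
  exists2 X : seq V, basis_of fullv X &
    forall i, (i <= n)%N -> step f i = <<take (cumul d i) X>>%VS.
Proof.
move=> /flags_of_typeP df.
pose Q (j : nat) : {vspace V} := if j == 0%N then 0%VS else fullv.
have cQ : chain 1 Q.
  by split=> // -[|i] [|j] // _; rewrite /Q /= ?sub0v ?subvv.
have gen : in_general_position n 1 (step f) Q.
  move=> i j iN _; have := dim_le_full (step f i); rewrite /Q; case: eqP => _.
    by rewrite addv0 dimv0; lia.
  by rewrite addvf; lia.
have [X [bX X1 _]] := adapted_basis (chain_step f) cQ gen.
by exists X => // i iN; rewrite {1}X1 // df.
Qed.

Lemma moved_by_exists g g' p : lker g == 0%VS -> lker g' == 0%VS ->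
  exists q, moved_by g g' p q.
Proof.
move=> kg kg'; have [f fE] := flag_img p.1 kg; have [h hE] := flag_img p.2 kg'.
by exists (f, h) => i iN; rewrite fE // hE.
Qed.

Lemma flags_of_type_img d g f f' : lker g == 0%VS ->
  (forall i, (i <= n)%N -> step f' i = (g @: step f i)%VS) ->
  flags_of_type d f -> flags_of_type d f'.
Proof.
move=> /eqP kg fE /flags_of_typeP df; apply/flags_of_typeP => i iN.
by rewrite fE // limg_dim_eq ?df // kg capv0.
Qed.

Lemma opposite_flag d e f : flags_of_type d f -> exists h, generic_pairs d e (f, h).
Proof.
move=> df; have [X bX fE] := flag_adapted df.
have [h [_ hE]] := flag_of_basis e (basis_of_rev bX).
by exists h; apply: generic_pair_of_basis bX fE hE.
Qed.

(** A basis adapted to f is moved to the reverse of a basis adapted to h. *)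
Lemma move_to_generic d e f h : flags_of_type d f -> flags_of_type e h ->
  exists2 g, lker g == 0%VS & forall f',
    (forall i, (i <= n)%N -> step f' i = (g @: step f i)%VS) -> generic_pairs d e (f', h).
Proof.
move=> df eh; have [X bX fE] := flag_adapted df; have [Y bY hE] := flag_adapted eh.
have [g kg gXY] := lker0_move_basis bX (basis_of_rev bY).
exists g => // f' f'E; apply: (generic_pair_of_basis (basis_of_rev bY)).
  by move=> i iN; rewrite f'E // fE // limg_span map_take gXY.
by move=> i iN; rewrite revK hE.
Qed.

Lemma lker_id : lker (\1%VF : 'End(V)) == 0%VS.
Proof. by apply/lker0P => x y; rewrite !id_lfunE. Qed.

Lemma lker_segment_id t : lker (segment (\1%VF : 'End(V)) t) == 0%VS.
Proof. by rewrite /segment -scalerDl subrK scale1r lker_id. Qed.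

Lemma moved_by_id p : moved_by \1%VF \1%VF p p.
Proof. by move=> i _; rewrite !lim1g. Qed.

(** Multiplying the restriction of P to a segment by that of a detector of
    generic pairs gives a polynomial that vanishes wherever the segment is
    invertible; as the detector does not vanish at t = 1, P vanishes on the
    whole segment. *)
Lemma generic_pairs_dense d e Z p : zariski_closed Z ->
  generic_pairs d e `<=` Z -> flags_of_type d p.1 -> flags_of_type e p.2 -> Z p.
Proof.
move=> [E hE ->] sub dp ep P EP; rewrite -/(pair_eval P p).
have hP := hE P EP.
have [g kg gen] := move_to_generic dp ep.
have [f' f'E] := flag_img p.1 kg; have gq := gen f' f'E.
have mq : moved_by g \1%VF p (f', p.2) by move=> i iN; rewrite f'E // lim1g.
have [W [hW Wq Wgen]] := generic_pairs_open gq.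
have QW : segment_eval W p g \1%VF != 0.
  apply: contraNneq Wq => QW0; rewrite -(@horner_segment_eval _ _ _ W p (f', p.2) g \1%VF 1) //.
  - by rewrite QW0 horner0.
  - by rewrite segment1.
  - exact: lker_segment_id.
  - by rewrite !segment1.
have QP : segment_eval P p g \1%VF = 0.
  apply/eqP/negPn/negP => QP.
  have /closed_nonrootP[t] : segment_eval P p g \1%VF * segment_eval W p g \1%VF * segment_det g != 0.
    by rewrite !mulf_neq0 // segment_det_neq0.
  rewrite /root !hornerM !mulf_eq0 !negb_or -lker_segment => /andP[/andP[Pt Wt] kt].
  have [qt mt] := moved_by_exists p kt (lker_segment_id t).
  have := sub qt _ P EP; rewrite -/(pair_eval P qt).
  have Wqt : pair_eval W qt != 0.
    by rewrite -(horner_segment_eval hW kt (lker_segment_id t) mt).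
  move=> /(_ _)/eqP; rewrite -(horner_segment_eval hP kt (lker_segment_id t) mt) => Pt0.
  move/negP: Pt; apply; apply: Pt0; apply: Wgen => //.
    by apply: flags_of_type_img dp; [exact: kt | move=> i iN; case: (mt i iN)].
  by apply: flags_of_type_img ep; [exact: (lker_segment_id t) | move=> i iN; case: (mt i iN)].
apply/eqP; rewrite -(@horner_segment_eval _ _ _ P p p g \1%VF 0) // ?segment0 ?lker_id //.
  by rewrite QP horner0.
exact: moved_by_id.
Qed.

(** Two flags of type e, one opposite to f and the other to h, are the ends of a
    segment; a parameter that is no root of either detector gives a flag which
    is opposite to both. *)
Lemma common_opposite_flag d e d' f h : flags_of_type d f -> flags_of_type d' h ->
  exists l, generic_pairs d e (f, l) /\ generic_pairs e d' (l, h).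
Proof.
move=> df dh; have [l0 gl0] := opposite_flag e df; have [_ el0 _] := gl0.
have [g kg gen] := move_to_generic el0 dh.
have [l1 l1E] := flag_img l0 kg; have gl1 := gen l1 l1E.
have [W0 [hW0 W0l W0gen]] := generic_pairs_open gl0.
have [W1 [hW1 W1l W1gen]] := generic_pairs_open gl1.
have Q0 : segment_eval W0 (f, l0) \1%VF g != 0.
  apply: contraNneq W0l => Q0; rewrite -(@horner_segment_eval _ _ _ W0 (f, l0) (f, l0) \1%VF g 0) //.
  - by rewrite Q0 horner0.
  - exact: lker_segment_id.
  - by rewrite segment0 lker_id.
  - by rewrite !segment0; apply: moved_by_id.
have Q1 : segment_eval W1 (l0, h) g \1%VF != 0.
  apply: contraNneq W1l => Q1; rewrite -(@horner_segment_eval _ _ _ W1 (l0, h) (l1, h) g \1%VF 1) //.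
  - by rewrite Q1 horner0.
  - by rewrite segment1.
  - exact: lker_segment_id.
  - by rewrite !segment1 => i iN; rewrite l1E // lim1g.
have /closed_nonrootP[t] :
    segment_eval W0 (f, l0) \1%VF g * segment_eval W1 (l0, h) g \1%VF * segment_det g != 0.
  by rewrite !mulf_neq0 // segment_det_neq0.
rewrite /root !hornerM !mulf_eq0 !negb_or -lker_segment => /andP[/andP[t0 t1] kt].
have [l lE] := flag_img l0 kt; exists l.
have el : flags_of_type e l by apply: flags_of_type_img lE el0.
have seg1 U : (segment (\1%VF : 'End(V)) t @: U)%VS = U.
  by rewrite /segment -scalerDl subrK scale1r lim1g.
have m0 : moved_by (segment \1%VF t) (segment g t) (f, l0) (f, l).
  by move=> i iN; rewrite seg1 lE.
have m1 : moved_by (segment g t) (segment \1%VF t) (l0, h) (l, h).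
  by move=> i iN; rewrite seg1 lE.
split; [apply: (W0gen (f, l) df el) | apply: (W1gen (l, h) el dh)].
  by rewrite -(horner_segment_eval hW0 (lker_segment_id t) kt m0).
by rewrite -(horner_segment_eval hW1 kt (lker_segment_id t) m1).
Qed.

Lemma generic_pairs_open_in d e S : generic_pairs d e `<=` S ->
  S `<=` flags_of_type d `*` flags_of_type e -> open_in S (generic_pairs d e).
Proof.
move=> gS Sde.
(* The closed set is cut out by all polynomials whose non-vanishing on F_d x F_e
   implies general position; their common zeros avoid the generic pairs. *)
pose E P := multihomogeneous P /\ forall q, flags_of_type d q.1 -> flags_of_type e q.2 ->
  pair_eval P q != 0 -> generic_pairs d e q.
exists [set p | forall P, E P -> pair_eval P p = 0].
  by exists E => // P [].
rewrite predeqE => p; split=> [gp|[Sp nZ]].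
  split; first exact: gS.
  have [W [hW Wp Wgen]] := generic_pairs_open gp => /(_ W) Z; move: Wp.
  by rewrite Z ?eqxx.
apply: contrapT => ngp; apply: nZ => P [_ EP]; apply/eqP/negPn/negP => Pp.
by apply: ngp; have [dp ep] := Sde p Sp; apply: EP.
Qed.
End Density.

(** * The algebra spanned by the open orbits *)

Section StarBilinear.
Variables (k : closedFieldType) (V : vectType k) (n r : nat).
Local Notation G := (G n r).

(** Evaluation at A, named to carry an additive structure. *)
Definition coefG (A : Theta n r) (x : G) : int := x A.

Fact coefG_zmod_morphism A : zmod_morphism (coefG A).
Proof. by move=> x y; rewrite /coefG !ffunE. Qed.
HB.instance Definition _ A :=
  GRing.isZmodMorphism.Build G int (coefG A) (coefG_zmod_morphism A).

Lemma coefG_basisG A B : coefG A (basisG B) = (A == B)%:R.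
Proof. by rewrite /coefG ffunE. Qed.

(** The product as a function of its left argument, to carry the additive
    structure. *)
Definition starl (y x : G) : G := star V x y.

Fact starl_zmod_morphism y : zmod_morphism (starl y).
Proof.
move=> x x'; rewrite /starl /star -sumrB; apply: eq_bigr => A _.
rewrite -sumrB; apply: eq_bigr => A' _.
by rewrite -[(x - x') A]/(coefG A _) raddfB /coefG /= mulrBl mulrzBr.
Qed.
HB.instance Definition _ y :=
  GRing.isZmodMorphism.Build G G (starl y) (starl_zmod_morphism y).

Fact star_zmod_morphism x : zmod_morphism (@star k V n r x).
Proof.
move=> y y'; rewrite /star -sumrB; apply: eq_bigr => A _.
rewrite -sumrB; apply: eq_bigr => A' _.
by rewrite -[(y - y') A']/(coefG A' _) raddfB /coefG /= mulrBr mulrzBr.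
Qed.
HB.instance Definition _ x :=
  GRing.isZmodMorphism.Build G G (@star k V n r x) (star_zmod_morphism x).

Lemma star_basisGE (A B : Theta n r) : star V (basisG A) (basisG B) = star_basis V A B.
Proof.
have bE (C C' : Theta n r) : basisG C C' = (C' == C)%:R by rewrite ffunE.
rewrite /star (bigD1 A isT) (bigD1 B isT) /= !bE !eqxx mulr1z.
rewrite big1 => [|B' /negbTE B'B]; last by rewrite !bE B'B mulr0 mulr0z.
rewrite big1 => [|A' /negbTE A'A]; first by rewrite !addr0.
by apply: big1 => B' _; rewrite !bE A'A mul0r mulr0z.
Qed.
End StarBilinear.

Section Algebra.
Variables (k : closedFieldType) (V : vectType k) (n : nat).
Local Notation r := (\dim {:V}).
Local Notation D := (D n r).
Local Notation Theta := (Theta n r).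
Local Notation flagpair := (flag V n * flag V n)%type.
Local Notation M := (M V n r).
Implicit Types (d e : D) (A B : Theta).

Lemma orbit_of_inj A B (p : flagpair) : orbit_of A p -> orbit_of B p -> A = B.
Proof.
move=> Ap Bp; apply/val_inj/matrixP => i j; apply/val_inj.
by rewrite /= -Ap -Bp.
Qed.

(** The matrix A such that e_A is the open orbit of F_d x F_e. *)
Definition thetaD d e : Theta := sval (cid (@orbit_of_generic_pairs _ V n d e)).

Lemma orbit_of_thetaD d e : orbit_of (thetaD d e) = generic_pairs d e :> set flagpair.
Proof. exact: svalP (cid (@orbit_of_generic_pairs _ V n d e)). Qed.

Lemma thetaD_inj d e d' e' : thetaD d e = thetaD d' e' -> (d, e) = (d', e').
Proof.
move=> E; have [p gp] := @generic_pairs_nonempty _ V n d e.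
have : generic_pairs d' e' p by rewrite -orbit_of_thetaD -E orbit_of_thetaD.
case: gp => dp ep _ [d'p e'p _].
by rewrite (flags_of_type_inj dp d'p) (flags_of_type_inj ep e'p).
Qed.

Lemma thetaD_eq d e d' e' : (thetaD d e == thetaD d' e') = (d == d') && (e == e').
Proof.
apply/eqP/andP => [/thetaD_inj[-> ->] //|[/eqP-> /eqP-> //]].
Qed.

(** Another orbit that is open in S would be disjoint from the generic pairs, so
    that these would lie in its closed complement; by density all of S would. *)
Lemma open_orbit_thetaD d e (S : set flagpair) : generic_pairs d e `<=` S ->
  S `<=` flags_of_type d `*` flags_of_type e -> open_orbit r S = basisG (thetaD d e).
Proof.
move=> gS Sde; have gO := generic_pairs_open_in gS Sde.
have [p gp] := @generic_pairs_nonempty _ V n d e.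
rewrite /open_orbit; case: pickP => [A /asboolP[[q qA] [Z cZ ZA]]|/(_ (thetaD d e))/asboolP[]].
  congr basisG; have [q' Aq'] : exists q' : flagpair, orbit_of A q'.
    exists q; rewrite qA; exists \1%VF; first by apply/lker0P => x y; rewrite !id_lfunE.
    by move=> i _; rewrite !lim1g.
  have [[s [gs As]]|none] := pselect (exists s, generic_pairs d e s /\ orbit_of A s).
    by apply: (orbit_of_inj As); rewrite orbit_of_thetaD.
  exfalso; move: Aq'; rewrite ZA => -[Sq' nZ]; apply: nZ.
  have [dq eq] := Sde _ Sq'; apply: (generic_pairs_dense cZ _ dq eq) => s gs.
  apply: contrapT => nZs; apply: none; exists s; split=> //.
  by rewrite ZA; split=> //; apply: gS.
rewrite orbit_of_thetaD; split=> //; exists p.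
by rewrite (generic_pairs_orbit gp).
Qed.

Lemma o_thetaD d e : o V d e = basisG (thetaD d e).
Proof. by apply: open_orbit_thetaD => // p [dp ep _]. Qed.

(** The middle flag forces e = d'; in that case the composable pairs contain all
    generic ones because any two flags have a common opposite. *)
Lemma star_o d e d' e' :
  star V (o V d e) (o V d' e') = if e == d' then o V d e' else 0.
Proof.
rewrite (o_thetaD d e) (o_thetaD d' e') star_basisGE /star_basis.
case: asboolP => [[[f h] [l [/=]]]|nS].
  rewrite !orbit_of_thetaD => -[_ el _] [d'l _ _].
  have ed' := flags_of_type_inj el d'l; subst d'; rewrite eqxx o_thetaD.
  apply: open_orbit_thetaD => [[f' h'] [df' eh' _]|].
    have [l' []] := common_opposite_flag e df' eh'.
    by exists l'; rewrite !orbit_of_thetaD.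
  move=> [f' h'] [l' []]; rewrite !orbit_of_thetaD => -[? _ _] [_ ? _].
  by split.
case: eqP => // ed'; case: nS.
have [[f h] [df eh _]] := @generic_pairs_nonempty _ V n d e'.
have [l [g1 g2]] := common_opposite_flag e df eh.
by exists (f, h), l; rewrite !orbit_of_thetaD -ed'.
Qed.

Definition omega0 (x : M) : matD n r :=
  \matrix_(i, j) coefG (thetaD (enum_val i) (enum_val j)) (val x).

Fact omega0_zmod_morphism : zmod_morphism omega0.
Proof. by move=> x y; apply/matrixP => i j; rewrite !mxE raddfB. Qed.
HB.instance Definition _ :=
  GRing.isZmodMorphism.Build M (matD n r) omega0 omega0_zmod_morphism.

Definition omega0_inv (N : matD n r) : M :=
  \sum_d \sum_e oM V d e *~ N (enum_rank d) (enum_rank e).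

Lemma coefG_o d e d' e' : coefG (thetaD d e) (o V d' e') = ((d == d') && (e == e'))%:R.
Proof. by rewrite o_thetaD coefG_basisG thetaD_eq. Qed.

Lemma val_omega0_inv N :
  val (omega0_inv N) = \sum_d \sum_e o V d e *~ N (enum_rank d) (enum_rank e).
Proof.
rewrite /omega0_inv raddf_sum; apply: eq_bigr => d _; rewrite raddf_sum.
by apply: eq_bigr => e _; rewrite raddfMz.
Qed.

Lemma coefG_sum_o (c : D -> D -> int) d e :
  coefG (thetaD d e) (\sum_d' \sum_e' o V d' e' *~ c d' e') = c d e.
Proof.
rewrite raddf_sum (bigD1 d) //= raddf_sum (bigD1 e) //= raddfMz /= coefG_o !eqxx /=.
rewrite !big1 ?addr0 ?intz // => [d' /negbTE dd'|e' /negbTE ee'].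
  by rewrite raddf_sum big1 // => e' _; rewrite raddfMz /= coefG_o eq_sym dd' mul0rz.
by rewrite raddfMz /= coefG_o [e == e']eq_sym ee' andbF mul0rz.
Qed.

Lemma omega0K : cancel omega0 omega0_inv.
Proof.
move=> x; apply: val_inj; rewrite val_omega0_inv.
have /asboolP[c xE] := M_valP x; rewrite [RHS]xE.
apply: eq_bigr => d _; apply: eq_bigr => e _; congr (_ *~ _).
by rewrite mxE !enum_rankK /= xE coefG_sum_o.
Qed.

Lemma omega0_invK : cancel omega0_inv omega0.
Proof.
move=> N; apply/matrixP => i j; rewrite mxE val_omega0_inv.
by rewrite (coefG_sum_o (fun d e => N (enum_rank d) (enum_rank e))) !enum_valK.
Qed.

Lemma omega0_is_omega0 : is_omega0 (omega0 : {additive M -> matD n r}).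
Proof.
move=> d e; apply/matrixP => i j; rewrite !mxE /= coefG_o.
by rewrite !(can2_eq (@enum_valK _) (@enum_rankK _)).
Qed.

Lemma star_o_sum d e (c : D -> D -> int) :
  star V (o V d e) (\sum_d' \sum_e' o V d' e' *~ c d' e') = \sum_e' o V d e' *~ c e e'.
Proof.
rewrite raddf_sum (bigD1 e) //= [X in _ + X]big1 ?addr0 => [|d' /negbTE d'e].
  by rewrite raddf_sum; apply: eq_bigr => e' _; rewrite raddfMz /= star_o eqxx.
by rewrite raddf_sum big1 // => e' _; rewrite raddfMz /= star_o eq_sym d'e mul0rz.
Qed.

Lemma star_omega0_inv N N' :
  star V (val (omega0_inv N)) (val (omega0_inv N')) = val (omega0_inv (N *m N')).
Proof.
rewrite !val_omega0_inv -[LHS]/(starl V _ _) raddf_sum; apply: eq_bigr => d _.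
rewrite raddf_sum /=.
under eq_bigr => e _ do rewrite raddfMz /= /starl star_o_sum mulrz_suml.
rewrite exchange_big; apply: eq_bigr => e _ /=.
rewrite mxE mulrz_sumr (reindex _ (onW_bij _ (@enum_rank_bij _))) /=.
by apply: eq_bigr => f _; rewrite -mulrzA mulrC.
Qed.

Lemma omega0_iso : is_Zalgebra_iso (omega0 : {additive M -> matD n r}).
Proof.
have starE (x y : M) : star V (val x) (val y) = val (omega0_inv (omega0 x *m omega0 y)).
  by rewrite -star_omega0_inv !omega0K.
split.
- by exists omega0_inv; [exact: omega0K | exact: omega0_invK].
- by move=> x y; exists (omega0_inv (omega0 x *m omega0 y)); rewrite ?starE //= omega0_invK.
- exists (omega0_inv 1%:M); last exact: omega0_invK.
  by move=> x; rewrite !starE omega0_invK mul1mx mulmx1 omega0K.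
Qed.

Lemma omega0_unique (w : {additive M -> matD n r}) : is_omega0 w -> w =1 omega0.
Proof.
move=> ww x; rewrite -[x]omega0K /omega0_inv !raddf_sum; apply: eq_bigr => d _.
rewrite !raddf_sum; apply: eq_bigr => e _; rewrite !raddfMz.
by congr (_ *~ _); rewrite ww omega0_is_omega0.
Qed.
End Algebra.

Theorem lemma9p7 (k : closedFieldType) (V : vectType k) (n r : nat)
    (n_ge1 : (1 <= n)%N) (r_ge1 : (1 <= r)%N) (dimV : \dim {:V} = r) :
  exists w : {additive M V n r -> matD n r},
    [/\ is_omega0 w,
        forall w' : {additive M V n r -> matD n r},
          is_omega0 w' -> w' =1 w
      & is_Zalgebra_iso w].
Proof.
subst r; exists (@omega0 k V n : {additive _ -> _}); split.
- exact: omega0_is_omega0.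
- exact: omega0_unique.
- exact: omega0_iso.
Qed.
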